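(* Let $\mathcal{H}$ be a separable Hilbert space and let $\xi=\{\xi_n\}_{n\in\mathbb{N}}$ be a lower semi-frame of $\mathcal{H}$ with analysis operator $C_\xi$ and generalized frame operator $T_\xi$. Let $\mathcal{H}_\xi=\overline{\mathcal{D}(C_\xi)}$ and let $P$ be the orthogonal projection of $\mathcal{H}$ onto $\mathcal{H}_\xi$. Then $\{T_\xi^{-1}P\xi_n\}_{n\in\mathbb{N}}$ is a Bessel sequence of $\mathcal{H}$ and $$g=\sum_{n\in\mathbb{N}}\langle g,\xi_n\rangle\,T_\xi^{-1}P\xi_n,\qquad \forall g\in\mathcal{D}(C_\xi),$$ with unconditional convergence in $\mathcal{H}$.
   Context: Inner products $\langle\cdot,\cdot\rangle$ are linear in the first variable. A sequence $\xi=\{\xi_n\}_{n\in\mathbb{N}}$ in $\mathcal{H}$ is a lower semi-frame of $\mathcal{H}$ if there is $A>0$ with $A\|f\|^2\le\sum_{n}|\langle f,\xi_n\rangle|^2$ for all $f\in\mathcal{H}$ (the sum may be $+\infty$), and a Bessel sequence of $\mathcal{H}$ if there is $B>0$ with $\sum_n|\langle f,\xi_n\rangle|^2\le B\|f\|^2$ for all $f\in\mathcal{H}$. The domain $\mathcal{D}(C_\xi)$ is not assumed dense in $\mathcal{H}$. The analysis operator $C_\xi$ has domain $\mathcal{D}(C_\xi)=\{f\in\mathcal{H}:\sum_n|\langle f,\xi_n\rangle|^2<\infty\}$ and $C_\xi f=\{\langle f,\xi_n\rangle\}_n\in\ell^2(\mathbb{N})$. Let $\mathcal{H}_\xi=\overline{\mathcal{D}(C_\xi)}$,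 a Hilbert space with the inner product of $\mathcal{H}$. The generalized frame operator $T_\xi:\mathcal{D}(T_\xi)\subseteq\mathcal{H}_\xi\to\mathcal{H}_\xi$ is defined as follows: $\mathcal{D}(T_\xi)$ is the set of $f\in\mathcal{D}(C_\xi)$ for which there is $h\in\mathcal{H}_\xi$ with $\sum_n\langle f,\xi_n\rangle\langle\xi_n,g\rangle=\langle h,g\rangle$ for all $g\in\mathcal{D}(C_\xi)$, and then $T_\xi f=h$ (unique). $T_\xi$ is positive and self-adjoint in $\mathcal{H}_\xi$; when $\xi$ is a lower semi-frame, $T_\xi:\mathcal{D}(T_\xi)\to\mathcal{H}_\xi$ is bijective with bounded inverse $T_\xi^{-1}:\mathcal{H}_\xi\to\mathcal{H}_\xi$. *)

(* Defs.v *)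
From HB Require Import structures.
From mathcomp Require Import all_boot all_order all_algebra.
From mathcomp Require Import sesquilinear complex.
From mathcomp Require Import all_classical all_reals all_analysis.

Set Implicit Arguments.
Unset Strict Implicit.
Unset Printing Implicit Defensive.

Import Order.TTheory GRing.Theory Num.Theory Num.Def.
Import numFieldNormedType.Exports.
Local Open Scope classical_set_scope.
Local Open Scope ring_scope.
Local Open Scope complex_scope.

Definition separable (T : topologicalType) : Prop :=
  exists2 D : set T, countable D & dense D.

(* Every rearrangement of the series converges, with the same sum [s]. *)
Definition unconditionally_sums_to (K : numFieldType) (V : normedModType K)
    (u : nat -> V) (s : V) : Prop :=
  forall sigma : nat -> nat, bijective sigma ->
    series (u \o sigma) @ \oo --> s.

Section SemiFrames.
Context (R : realType) (H : completeNormedModType R[i]) (ip : {dot H for conjC}).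

(* Norms in a [normedModType R[i]] take values in [R[i]], with zero imaginary
   part; [complex.Re] reads them in [R]. *)
Definition sqnorm (f : H) : R := complex.Re `|f| ^+ 2.

Definition analysis_op (xi : nat -> H) (f : H) : nat -> R[i] :=
  fun n => ip f (xi n).

Definition sum_sq (c : nat -> R[i]) : \bar R :=
  (\sum_(0 <= n <oo) (complex.Re `|c n| ^+ 2)%:E)%E.

Definition lower_semi_frame (xi : nat -> H) : Prop :=
  exists2 A : R, 0 < A &
    forall f : H, ((A * sqnorm f)%:E <= sum_sq (analysis_op xi f))%E.

Definition bessel_sequence (xi : nat -> H) : Prop :=
  exists2 B : R, 0 < B &
    forall f : H, (sum_sq (analysis_op xi f) <= (B * sqnorm f)%:E)%E.

Definition analysis_dom (xi : nat -> H) : set H :=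
  [set f | (sum_sq (analysis_op xi f) < +oo)%E].

Definition Hspace (xi : nat -> H) : set H := closure (analysis_dom xi).

(* [R[i]^o] is [R[i]] with its topology as a normed space over itself. *)
Definition gframe_rel (xi : nat -> H) (f h : H) : Prop :=
  Hspace xi h /\
  forall g : H, analysis_dom xi g ->
    series (fun n => analysis_op xi f n * ip (xi n) g : R[i]^o) @ \oo
      --> (ip h g : R[i]^o).

Definition gframe_dom (xi : nat -> H) : set H :=
  [set f | analysis_dom xi f /\ exists h, gframe_rel xi f h].

(* The [h] in question is unique, as [analysis_dom xi] is dense in
   [Hspace xi]; [0] is a dummy for the case where there is none. *)
Definition gframe_op (xi : nat -> H) (f : H) : H :=
  xget 0 [set h | gframe_rel xi f h].

(* For a lower semi-frame [gframe_op xi] is a bijection from [gframe_dom xi]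
   onto [Hspace xi], so [0] is a dummy used only outside [Hspace xi]. *)
Definition gframe_inv (xi : nat -> H) (h : H) : H :=
  xget 0 [set f | gframe_dom xi f /\ gframe_op xi f = h].

(* The dummy [0] plays no role when [M] is a closed subspace. *)
Definition orth_proj (M : set H) (f : H) : H :=
  xget 0 [set p | M p /\ forall g, M g -> ip (f - p) g = 0].

End SemiFrames.

(* Main.v *)
Require Import Defs.
From HB Require Import structures.
From mathcomp Require Import all_boot all_order all_algebra.
From mathcomp Require Import sesquilinear complex.
From mathcomp Require Import all_classical all_reals all_analysis.
From mathcomp Require Import ring lra.

(** On [D(C)] consider the form [B(f, g) = sum_n <f, xi_n> <xi_n, g>].  It is
    closed, and coercive by the lower frame bound, so minimising
    [B(u, u) - 2 Re <u, f>] gives for every [f] in [H] some [u] in [D(C)] with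
    [B(u, g) = <f, g>] for all [g] in [D(C)].  The dual vector
    [eta_n = T^-1 P xi_n] is the representative of [xi_n], so
    [<f, eta_n> = <u, xi_n>].  Hence [sum_n |<f, eta_n>|^2 = B(u, u) = <f, u>],
    which the frame bound turns into the Bessel bound, and
    [<g, f> = B(g, u) = sum_n <g, xi_n> <eta_n, f>], which is the expansion of
    [g] in the weak sense.  For a Bessel sequence the squared norm of the error
    of a partial sum is an inner product of tails in [l^2], so weak convergence
    is norm convergence; and inner products in [l^2] are invariant under
    rearrangement because, by polarization, they are combinations of sums of
    nonnegative terms. *)

Set Implicit Arguments.
Unset Strict Implicit.
Unset Printing Implicit Defensive.

Import Order.TTheory GRing.Theory Num.Theory Num.Def.
Import numFieldNormedType.Exports.
Local Open Scope classical_set_scope.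
Local Open Scope ring_scope.
Local Open Scope complex_scope.

Local Notation Re := complex.Re.
Local Notation Im := complex.Im.

Section ComplexRealParts.
Context {R : rcfType}.
Implicit Types z w : R[i].

Lemma ReD z w : Re (z + w) = Re z + Re w.
Proof. by case: z w => [a b] [c d]. Qed.

Lemma ReN z : Re (- z) = - Re z.
Proof. by case: z. Qed.

Lemma ReJ z : Re (conjC z) = Re z.
Proof. by case: z. Qed.

Lemma ReZ (t : R) z : Re (t%:C * z) = t * Re z.
Proof. by case: z => a b /=; rewrite mul0r subr0. Qed.

Lemma conjC_real (t : R) : conjC (t%:C) = t%:C :> R[i].
Proof. exact: conjc_real. Qed.

Lemma conjC_i : conjC 'i = - 'i :> R[i].
Proof. by apply/eqP; rewrite eq_complex /= oppr0 !eqxx. Qed.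

Lemma ge0_Re_complex z : 0 <= z -> z = (Re z)%:C.
Proof. by move=> z_ge0; rewrite RRe_real // ger0_real. Qed.

End ComplexRealParts.

Definition subspace {K : pzRingType} {V : lmodType K} (M : set V) : Prop :=
  M 0 /\ forall a f g, M f -> M g -> M (a *: f + g).

Section Subspaces.
Context {K : pzRingType} {V : lmodType K} (M : set V).
Hypothesis M_subspace : subspace M.

Lemma subspace0 : M 0.
Proof. by case: M_subspace. Qed.

Lemma subspaceZD a f g : M f -> M g -> M (a *: f + g).
Proof. by case: M_subspace => _; apply. Qed.

Lemma subspaceD f g : M f -> M g -> M (f + g).
Proof. by move=> Mf Mg; rewrite -[f]scale1r; exact: subspaceZD. Qed.

Lemma subspaceZ a f : M f -> M (a *: f).
Proof. by move=> Mf; rewrite -[_ *: _]addr0; exact: subspaceZD subspace0. Qed.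

Lemma subspaceB f g : M f -> M g -> M (f - g).
Proof. by move=> Mf Mg; rewrite addrC -scaleN1r; exact: subspaceZD. Qed.

End Subspaces.

Lemma subspace_preimage {K : pzRingType} {V W : lmodType K} (L : V -> W)
    (M : set W) : linear L -> subspace M -> subspace (L @^-1` M).
Proof.
move=> linL [M0 MZD]; split=> [|a f g Mf Mg] /=; last first.
  by rewrite linL; exact: MZD.
by have := linL (-1) 0 0; rewrite scaler0 addr0 scaleN1r addNr => ->.
Qed.

Lemma closure_sub_closed {T : topologicalType} (A E : set T) :
  A `<=` E -> closed E -> closure A `<=` E.
Proof. by move=> AE closedE; exact: subset_trans (closureS AE) closedE. Qed.

Lemma closure_subspace {K : numFieldType} {V : normedModType K} (M : set V) :
  subspace M -> subspace (closure M).
Proof.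
move=> M_sub; have clM := @subset_closure _ M.
split=> [|a f g]; first exact/clM/(subspace0 M_sub).
have closed_l g' : closed [set f' | closure M (a *: f' + g')].
  apply: (@preimage_closed _ _ (fun f' => a *: f' + g')) (@closed_closure _ _).
  move=> f' _; apply: cvgD; last exact: cvg_cst.
  exact: scaler_continuous.
have closed_r f' : closed [set g' | closure M (a *: f' + g')].
  apply: (@preimage_closed _ _ (fun g' => a *: f' + g')) (@closed_closure _ _).
  by move=> g' _; apply: cvgD; [exact: cvg_cst|exact: cvg_id].
move=> Mf; apply: (closure_sub_closed _ (closed_r f)) => g' Mg' /=; move: f Mf.
apply: (closure_sub_closed _ (closed_l g')) => f' Mf' /=.
by apply: clM; exact: subspaceZD.
Qed.

Record semi_inner_product {R : rcfType} {V : lmodType R[i]} (M : set V)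
    (b : V -> V -> R[i]) : Prop := {
  sip_subspace : subspace M;
  sipZDl : forall a f g h, M f -> M g -> M h ->
    b (a *: f + g) h = a * b f h + b g h;
  sipC : forall f g, M f -> M g -> b f g = conjC (b g f);
  sip_ge0 : forall f, M f -> 0 <= b f f }.

Lemma sip_preimage {R : rcfType} {V W : lmodType R[i]} (L : V -> W)
    (M : set W) (b : W -> W -> R[i]) :
  linear L -> semi_inner_product M b ->
  semi_inner_product (L @^-1` M) (fun f g => b (L f) (L g)).
Proof.
move=> linL [M_sub bZDl bC b_ge0]; split.
- exact: subspace_preimage.
- by move=> a f g h Mf Mg Mh; rewrite linL bZDl.
- by move=> f g Mf Mg; exact: bC.
- by move=> f Mf; exact: b_ge0.
Qed.

Section SemiInnerProducts.
Context {R : rcfType} {V : lmodType R[i]} (M : set V) (b : V -> V -> R[i]).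
Hypothesis b_sip : semi_inner_product M b.
Let M_sub := sip_subspace b_sip.

Lemma sipDl f g h : M f -> M g -> M h -> b (f + g) h = b f h + b g h.
Proof.
by move=> Mf Mg Mh; rewrite -[f]scale1r (sipZDl b_sip) // mul1r scale1r.
Qed.

Lemma sipZl a f h : M f -> M h -> b (a *: f) h = a * b f h.
Proof.
move=> Mf Mh; have M0 := subspace0 M_sub.
have b0 : b 0 h = 0.
  by apply: (addrI (b 0 h)); rewrite -(sipDl M0 M0 Mh) !addr0.
by rewrite -[a *: f]addr0 (sipZDl b_sip) // b0 addr0.
Qed.

Lemma sipDr f g h : M f -> M g -> M h -> b h (f + g) = b h f + b h g.
Proof.
move=> Mf Mg Mh; have Mfg := subspaceD M_sub Mf Mg.
rewrite (sipC b_sip) ?sipDl ?rmorphD //=.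
by rewrite -!(sipC b_sip).
Qed.

Lemma sipZr a f h : M f -> M h -> b h (a *: f) = conjC a * b h f.
Proof.
move=> Mf Mh; rewrite (sipC b_sip) ?sipZl ?rmorphM //=; last exact: subspaceZ.
by rewrite -(sipC b_sip).
Qed.

Lemma sip_real f : M f -> b f f = (Re (b f f))%:C.
Proof. by move=> Mf; exact/ge0_Re_complex/(sip_ge0 b_sip). Qed.

Lemma Re_sip_ge0 f : M f -> 0 <= Re (b f f).
Proof. by move=> Mf; rewrite -ler0c -sip_real // (sip_ge0 b_sip). Qed.

Lemma sip_polarization f g : M f -> M g ->
  b f g = (b (f + g) (f + g) - b f f - b g g) / 2
    + 'i * (b (f + 'i *: g) (f + 'i *: g) - b f f - b g g) / 2.
Proof.
move=> Mf Mg; have Mig := subspaceZ M_sub 'i Mg.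
have [Mfg Mfig] := (subspaceD M_sub Mf Mg, subspaceD M_sub Mf Mig).
rewrite !sipDl // !sipDr // sipZl // !sipZr // sipZl // conjC_i.
have i2 : 'i * 'i = -1 :> R[i] by rewrite -expr2 sqr_i.
by field: i2.
Qed.

Lemma Re_sip_sqrD (t : R) f g : M f -> M g ->
  Re (b (f + t%:C *: g) (f + t%:C *: g)) =
  Re (b f f) + 2 * t * Re (b f g) + t ^+ 2 * Re (b g g).
Proof.
move=> Mf Mg; have Mtg := subspaceZ M_sub t%:C Mg.
have Mftg := subspaceD M_sub Mf Mtg.
rewrite sipDl // !sipDr // !sipZl // !sipZr // conjC_real.
by rewrite [b g f](sipC b_sip) // !(ReD, ReZ, ReJ); ring.
Qed.

Lemma Re_sip_young (t : R) f g : M f -> M g ->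
  2 * t * Re (b f g) <= Re (b f f) + t ^+ 2 * Re (b g g).
Proof.
move=> Mf Mg; have Mtg := subspaceZ M_sub (- t)%:C Mg.
have := Re_sip_ge0 (subspaceD M_sub Mf Mtg).
by rewrite Re_sip_sqrD // sqrrN; lra.
Qed.

Lemma Re_sip_sqrD_le f g : M f -> M g ->
  Re (b (f + g) (f + g)) <= 2 * Re (b f f) + 2 * Re (b g g).
Proof.
move=> Mf Mg; have := Re_sip_sqrD 1 Mf Mg; rewrite rmorph1 scale1r => ->.
by have := Re_sip_young 1 Mf Mg; lra.
Qed.

Lemma Re_sip_sqrZ a f : M f ->
  Re (b (a *: f) (a *: f)) = Re (a * conjC a) * Re (b f f).
Proof.
move=> Mf; rewrite sipZl ?sipZr //; last exact: (subspaceZ M_sub).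
by rewrite mulrA {1}(ge0_Re_complex (mul_conjC_ge0 a)) ReZ.
Qed.

Lemma norm_sip_le f g : M f -> M g -> 2 * `|b f g| <= b f f + b g g.
Proof.
move=> Mf Mg; have [z0|z_neq0] := eqVneq (b f g) 0.
  by rewrite z0 normr0 mulr0 addr_ge0 // (sip_ge0 b_sip).
pose phase := conjC (b f g) / `|b f g|.
have phase_norm : phase * conjC phase = 1.
  rewrite -normCK normf_div norm_conjC normr_id divff ?expr1n //.
  by rewrite normr_eq0.
have phaseM : phase * b f g = `|b f g|.
  by rewrite /phase mulrAC [_ * b f g]mulrC -normCK expr2 mulfK ?normr_eq0.
have Mpf := subspaceZ M_sub phase Mf.
have young : 2 * Re `|b f g| <= Re (b f f) + Re (b g g).
  have := Re_sip_young 1 Mpf Mg.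
  by rewrite Re_sip_sqrZ // phase_norm sipZl // phaseM expr1n mulr1 !mul1r.
rewrite (sip_real Mf) (sip_real Mg) [`|b f g|]ge0_Re_complex //.
by rewrite -[2](rmorph_nat (real_complex R)) -rmorphM -rmorphD lecR.
Qed.

End SemiInnerProducts.

Section ComplexTopology.
Context {R : realType}.

Lemma cvg_Re {T : Type} {F : set_system T} {FF : Filter F}
    (u : T -> R[i]^o) (l : R[i]^o) :
  u @ F --> l -> Re (u x) @[x --> F] --> Re l.
Proof.
move=> ul; apply/cvgrPdist_lt => e e_gt0; near=> x.
rewrite -ltcR -ReN -ReD; apply: le_lt_trans (normc_ge_Re _) _; near: x.
by apply: cvgr_dist_lt ul _ _; rewrite ltcR.
Unshelve. all: by end_near. Qed.

Lemma cvg_real_complex {T : Type} {F : set_system T} {FF : Filter F}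
    (u : T -> R) (l : R) :
  u @ F --> l -> ((u x)%:C : R[i]^o) @[x --> F] --> (l%:C : R[i]^o).
Proof.
move=> ul; apply/cvgrPdist_lt => -[e e'].
rewrite ltcE /= => /andP[/eqP -> e_gt0]; near=> x.
rewrite -rmorphB normc_def /= expr0n addr0 sqrtr_sqr ltcR; near: x.
exact: cvgr_dist_lt ul _ e_gt0.
Unshelve. all: by end_near. Qed.

Lemma cvg_conjC {T : Type} {F : set_system T} {FF : Filter F}
    (u : T -> R[i]^o) (l : R[i]^o) :
  u @ F --> l -> (conjC (u x) : R[i]^o) @[x --> F] --> (conjC l : R[i]^o).
Proof.
move=> ul; apply/cvgrPdist_lt => e e_gt0; near=> x.
rewrite -rmorphB norm_conjC; near: x.
exact: cvgr_dist_lt ul _ e_gt0.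
Unshelve. all: by end_near. Qed.

Lemma norm_Re_complex {V : normedModType R[i]} (f : V) : `|f| = (Re `|f|)%:C.
Proof. exact: ge0_Re_complex. Qed.

Lemma Re_norm_ge0 {V : normedModType R[i]} (f : V) : 0 <= Re `|f|.
Proof. by rewrite -ler0c -norm_Re_complex. Qed.

Lemma complex_cvg_unique (u : nat -> R[i]^o) (a b : R[i]^o) :
  u @ \oo --> a -> u @ \oo --> b -> a = b.
Proof. exact: (cvg_unique (@norm_hausdorff _ _)). Qed.

End ComplexTopology.

Section SquareSummable.
Context {R : realType}.
Implicit Types a c d e : nat -> R[i]^o.

Definition partial_dot (n : nat) a c : R[i]^o :=
  \sum_(0 <= k < n) a k * conjC (c k).

Definition square_summable : set (nat -> R[i]^o) :=
  [set c | (sum_sq c < +oo)%E].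

Definition l2_dot a c : R[i]^o := lim (partial_dot n a c @[n --> \oo]).

Lemma partial_dot_sip n : semi_inner_product setT (partial_dot n).
Proof.
split=> // [a c d e _ _ _|a c _ _|c _].
- rewrite /partial_dot mulr_sumr -big_split /=; apply: eq_bigr => k _.
  by rewrite mulrDl mulrA.
- rewrite /partial_dot rmorph_sum /=; apply: eq_bigr => k _.
  by rewrite rmorphM /= conjCK mulrC.
- by apply: sumr_ge0 => k _; exact: mul_conjC_ge0.
Qed.

Lemma partial_dot_diag n c :
  partial_dot n c c = (\sum_(0 <= k < n) Re `|c k| ^+ 2)%:C.
Proof.
rewrite rmorph_sum; apply: eq_bigr => k _.
by rewrite -normCK norm_Re_complex -rmorphXn.
Qed.

Lemma cvg_partial_dot {T : Type} {F : set_system T} {FF : Filter F}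
    (u v : T -> nat -> R[i]^o) a c n :
  (forall k, u x k @[x --> F] --> a k) ->
  (forall k, v x k @[x --> F] --> c k) ->
  partial_dot n (u x) (v x) @[x --> F] --> partial_dot n a c.
Proof.
move=> u_cvg v_cvg; apply: cvg_big => [|k _]; first exact: add_continuous.
by apply: cvgM (u_cvg k) _; exact: cvg_conjC.
Qed.

Lemma cvg_sum_sq c : (Re (partial_dot n c c))%:E @[n --> \oo] --> sum_sq c.
Proof.
under eq_fun do rewrite partial_dot_diag /= -sumEFin.
by apply: is_cvg_nneseries => k _ _; rewrite lee_fin sqr_ge0.
Qed.

Lemma partial_dot_le_sum_sq c n : ((Re (partial_dot n c c))%:E <= sum_sq c)%E.
Proof.
rewrite partial_dot_diag /= -sumEFin; apply: nneseries_lim_ge => k _ _.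
by rewrite lee_fin sqr_ge0.
Qed.

Lemma sum_sq_leP c (l : \bar R) :
  (sum_sq c <= l)%E <-> forall n, ((Re (partial_dot n c c))%:E <= l)%E.
Proof.
split=> [c_le n|c_le]; first exact: le_trans (partial_dot_le_sum_sq c n) c_le.
have cvg_c := @cvg_sum_sq c; rewrite -(cvg_lim _ cvg_c) //.
by apply: lime_le; [exact/cvg_ex/ex_intro/cvg_c|exact: nearW].
Qed.

Lemma sum_sq_fineK c : square_summable c -> (fine (sum_sq c))%:E = sum_sq c.
Proof.
move=> c_fin; rewrite fineK // ge0_fin_numE //.
by apply: nneseries_ge0 => k _ _; rewrite lee_fin sqr_ge0.
Qed.

Lemma square_summableP c :
  square_summable c <-> exists l : R, forall n, Re (partial_dot n c c) <= l.
Proof.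
split=> [c_fin|[l c_le]].
  exists (fine (sum_sq c)) => n.
  by rewrite -lee_fin sum_sq_fineK // partial_dot_le_sum_sq.
apply: (@le_lt_trans _ _ l%:E); last exact: ltry.
by apply/sum_sq_leP => n; rewrite lee_fin.
Qed.

Lemma square_summable_subspace : subspace square_summable.
Proof.
split=> [|a c d /square_summableP[l c_le] /square_summableP[m d_le]].
  apply/square_summableP; exists 0 => n.
  by rewrite /partial_dot big1 // => k _; rewrite mul0r.
apply/square_summableP; exists (2 * (Re (a * conjC a) * l) + 2 * m) => n.
apply: le_trans (Re_sip_sqrD_le (partial_dot_sip n) I I) _.
rewrite (Re_sip_sqrZ (partial_dot_sip n)) //.
have aa_ge0 : 0 <= Re (a * conjC a).
  by rewrite -ler0c -ge0_Re_complex ?mul_conjC_ge0.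
by apply: lerD; rewrite ler_pM2l // ler_wpM2l.
Qed.

Lemma cvg_partial_dot_diag c : square_summable c ->
  partial_dot n c c @[n --> \oo] --> ((fine (sum_sq c))%:C : R[i]^o).
Proof.
move=> c_fin.
have := @cvg_sum_sq c; rewrite -sum_sq_fineK // => /fine_cvg c_cvg.
under eq_fun do rewrite (sip_real (partial_dot_sip _)) //.
exact: cvg_real_complex c_cvg.
Qed.

Lemma cvg_l2_dot a c : square_summable a -> square_summable c ->
  partial_dot n a c @[n --> \oo] --> l2_dot a c.
Proof.
move=> a_fin c_fin.
have sum_fin := subspaceD square_summable_subspace a_fin c_fin.
have ic_fin := subspaceZ square_summable_subspace 'i c_fin.
have sum_i_fin := subspaceD square_summable_subspace a_fin ic_fin.
suff : cvgn (fun n => partial_dot n a c) by [].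
under eq_fun do rewrite (sip_polarization (partial_dot_sip _)) //.
have is_cvg_diag d : square_summable d -> cvgn (fun n => partial_dot n d d).
  by move=> d_fin; exact/cvgP/cvg_partial_dot_diag.
apply: is_cvgD; apply: is_cvgM; [|exact: is_cvg_cst|
  apply: is_cvgM; first exact: is_cvg_cst|exact: is_cvg_cst];
  do 2?[apply: is_cvgB]; exact: is_cvg_diag.
Qed.

Lemma l2_dotP a c (l : R[i]^o) : square_summable a -> square_summable c ->
  partial_dot n a c @[n --> \oo] --> l -> l2_dot a c = l.
Proof. by move=> a_fin c_fin; exact/complex_cvg_unique/cvg_l2_dot. Qed.

Lemma l2_dot_diag c : square_summable c -> l2_dot c c = (fine (sum_sq c))%:C.
Proof. by move=> c_fin; apply: l2_dotP => //; exact: cvg_partial_dot_diag. Qed.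

Lemma Re_l2_dot_diag c :
  square_summable c -> (Re (l2_dot c c))%:E = sum_sq c.
Proof. by move=> c_fin; rewrite l2_dot_diag //= sum_sq_fineK. Qed.

Lemma l2_dot_sip : semi_inner_product square_summable l2_dot.
Proof.
split=> [|a c d e c_fin d_fin e_fin|a c a_fin c_fin|c c_fin].
- exact: square_summable_subspace.
- apply: l2_dotP => //; first exact: (subspaceZD square_summable_subspace).
  under eq_fun do rewrite (sipZDl (partial_dot_sip _)) //.
  by apply: cvgD; [apply: cvgM; first exact: cvg_cst|]; exact: cvg_l2_dot.
- apply: l2_dotP => //; under eq_fun do rewrite (sipC (partial_dot_sip _)) //.
  by apply: cvg_conjC; exact: cvg_l2_dot.
- rewrite l2_dot_diag // ler0c fine_ge0 // nneseries_ge0 // => k _ _.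
  by rewrite lee_fin sqr_ge0.
Qed.

Lemma l2_tail_sip N :
  semi_inner_product square_summable
    (fun a c => l2_dot a c - partial_dot N a c).
Proof.
have [l2_sip partial_sip] := (l2_dot_sip, partial_dot_sip N).
split=> [|a c d e c_fin d_fin e_fin|a c a_fin c_fin|c c_fin].
- exact: square_summable_subspace.
- by rewrite (sipZDl l2_sip) // (sipZDl partial_sip) // mulrBr opprD addrACA.
- by rewrite rmorphB (sipC l2_sip) // (sipC partial_sip).
- rewrite subr_ge0 (sip_real l2_sip) // (sip_real partial_sip) // lecR -lee_fin.
  by rewrite Re_l2_dot_diag // partial_dot_le_sum_sq.
Qed.

Lemma sum_sq_perm (s : nat -> nat) c :
  bijective s -> sum_sq (c \o s) = sum_sq c.
Proof.
move=> s_bij; rewrite /sum_sq.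
rewrite !nneseries_esumT => [|n|n]; rewrite ?lee_fin ?sqr_ge0 //.
by rewrite [RHS](reindex_esum setT setT s) // setTT_bijective.
Qed.

Lemma square_summable_perm (s : nat -> nat) c : bijective s ->
  square_summable (c \o s) <-> square_summable c.
Proof. by move=> s_bij; rewrite /square_summable /= sum_sq_perm. Qed.

Lemma l2_dot_perm (s : nat -> nat) a c : bijective s ->
  square_summable a -> square_summable c ->
  l2_dot (a \o s) (c \o s) = l2_dot a c.
Proof.
move=> s_bij a_fin c_fin; have perm_fin d := square_summable_perm d s_bij.
have norm_perm d : square_summable d -> l2_dot (d \o s) (d \o s) = l2_dot d d.
  move=> d_fin; rewrite !l2_dot_diag ?sum_sq_perm //; exact/perm_fin.
have sum_fin := subspaceD square_summable_subspace a_fin c_fin.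
have ic_fin := subspaceZ square_summable_subspace 'i c_fin.
have sum_i_fin := subspaceD square_summable_subspace a_fin ic_fin.
have as_fin := (perm_fin a).2 a_fin; have cs_fin := (perm_fin c).2 c_fin.
rewrite (sip_polarization l2_dot_sip as_fin cs_fin).
rewrite (sip_polarization l2_dot_sip a_fin c_fin).
by rewrite -(norm_perm _ a_fin) -(norm_perm _ c_fin) -(norm_perm _ sum_fin)
  -(norm_perm _ sum_i_fin).
Qed.

End SquareSummable.

Section SquaredNorm.
Context {R : realType} {H : completeNormedModType R[i]}.
Implicit Types f : H.

Lemma sqnorm_eq0 f : sqnorm f = 0 -> f = 0.
Proof.
move=> /eqP; rewrite sqrf_eq0 => /eqP norm0; apply/normr0_eq0.
by rewrite norm_Re_complex norm0.
Qed.

Lemma normr_lt_sqnorm f (e : R) : 0 < e -> (`|f| < e%:C) = (sqnorm f < e ^+ 2).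
Proof.
move=> e_gt0; rewrite norm_Re_complex ltcR /sqnorm.
by rewrite ltr_pXn2r // nnegrE ?Re_norm_ge0 ?ltW.
Qed.

Lemma cvg_sqnorm (u : nat -> H) f :
  sqnorm (f - u n) @[n --> \oo] --> 0 -> u @ \oo --> f.
Proof.
move=> /cvgrPdist_lt u_cvg; apply/cvgrPdist_lt => -[e e'].
rewrite ltcE /= => /andP[/eqP -> e_gt0].
have := u_cvg (e ^+ 2); rewrite exprn_gt0 // => /(_ isT); apply: filterS => n.
by rewrite sub0r normrN ger0_norm ?sqr_ge0 // normr_lt_sqnorm.
Qed.

Lemma cauchy_sqnorm_cvg (u : nat -> H) :
  (forall e : R, 0 < e ->
     exists N, forall n, (N <= n)%N -> sqnorm (u N - u n) < e) ->
  cvg (u @ \oo).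
Proof.
move=> u_cauchy; apply: cauchy_cvg; apply: cauchy_exP => -[e e'].
rewrite ltcE /= => /andP[/eqP -> e_gt0].
have [N u_near] := u_cauchy _ (exprn_gt0 2 e_gt0).
exists (u N), N => // n /u_near.
by rewrite -ball_normE /ball_ /= normr_lt_sqnorm.
Qed.

End SquaredNorm.

Section InnerProductSpace.
Context {R : realType} {H : completeNormedModType R[i]}.
Variable ip : {dot H for conjC}.
Hypothesis ip_norm : forall f : H, ip f f = `|f| ^+ 2.
Implicit Types (f g h : H) (M : set H).

Lemma ip_sip M : subspace M -> semi_inner_product M ip.
Proof.
move=> M_sub; split=> // [a f g h _ _ _|f g _ _].
- by rewrite linearDl linearZl_LR.
- by rewrite hermC expr0 mul1r.
Qed.

Lemma ip_sipT : semi_inner_product setT ip.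
Proof. exact: ip_sip. Qed.

Lemma ipC f g : ip f g = conjC (ip g f).
Proof. by rewrite (sipC ip_sipT). Qed.

Lemma ip_sqnorm f : ip f f = (sqnorm f)%:C.
Proof. by rewrite ip_norm norm_Re_complex -rmorphXn. Qed.

Lemma Re_ip_young (t : R) f g :
  2 * t * Re (ip f g) <= sqnorm f + t ^+ 2 * sqnorm g.
Proof.
by have := Re_sip_young ip_sipT t (f := f) (g := g) I I; rewrite !ip_sqnorm.
Qed.

Lemma continuous_ip g : continuous (fun f => ip f g : R[i]^o).
Proof.
pose L : {linear H -> R[i]^o} := applyr ip g.
apply: (@bounded_linear_continuous _ _ _ L); apply/bounded_funP => r.
exists (r ^+ 2 + `|g| ^+ 2) => f f_le /=.
apply: (@le_trans _ _ (2 * `|ip f g|)); first by rewrite ler_peMl // ler1n.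
apply: le_trans (norm_sip_le ip_sipT I I) _; rewrite !ip_norm lerD2r.
by rewrite lerXn2r // nnegrE //; exact: le_trans f_le.
Qed.

Lemma cvg_ip {T : Type} {F : set_system T} {FF : Filter F} (u : T -> H) f g :
  u @ F --> f -> (ip (u x) g : R[i]^o) @[x --> F] --> (ip f g : R[i]^o).
Proof. by move=> u_cvg; exact: cvg_comp u_cvg (@continuous_ip g f). Qed.

Lemma orthogonal_closure M g :
  (forall f, M f -> ip f g = 0) -> forall f, closure M f -> ip f g = 0.
Proof.
move=> Mg; apply: closure_sub_closed Mg _.
have closed0 : closed [set (0 : R[i]^o)].
  exact/accessible_closed_set1/hausdorff_accessible/norm_hausdorff.
by apply: preimage_closed closed0 => f _; exact: continuous_ip.
Qed.

End InnerProductSpace.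

Lemma linear_term_eq0 {R : realFieldType} (x q : R) :
  0 <= q -> (forall t, 0 <= t * x + t ^+ 2 * q) -> x = 0.
Proof.
move=> q_ge0 /(_ (- x / (q + 1))); have q1_gt0 : 0 < q + 1 by lra.
have -> : - x / (q + 1) * x + (- x / (q + 1)) ^+ 2 * q = - (x / (q + 1)) ^+ 2.
  by field; rewrite gt_eqF.
rewrite oppr_ge0 => x_le0; apply/eqP.
have : (x / (q + 1)) ^+ 2 == 0 by rewrite eq_le x_le0 sqr_ge0.
by rewrite sqrf_eq0 mulf_eq0 invr_eq0 (gt_eqF q1_gt0) orbF.
Qed.

Section CoerciveRepresentation.
Context {R : realType} {H : completeNormedModType R[i]}.
Variable ip : {dot H for conjC}.
Hypothesis ip_norm : forall f : H, ip f f = `|f| ^+ 2.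
Variables (M : set H) (b : H -> H -> R[i]) (A : R).
Hypotheses (b_sip : semi_inner_product M b) (A_gt0 : 0 < A).
Hypothesis b_coercive : forall f, M f -> A * sqnorm f <= Re (b f f).
Hypothesis b_sublevel_closed :
  forall l : R, closed [set f | M f /\ Re (b f f) <= l].
Variable h : H.
Implicit Types f g : H.

Let M_sub := sip_subspace b_sip.

Definition riesz_energy f : R := Re (b f f) - 2 * Re (ip f h).

Local Notation J := riesz_energy.

Lemma riesz_energyD f g (t : R) : M f -> M g ->
  J (f + t%:C *: g) =
  J f + 2 * t * (Re (b f g) - Re (ip g h)) + t ^+ 2 * Re (b g g).
Proof.
move=> Mf Mg; rewrite /J (Re_sip_sqrD b_sip) //.
have -> : ip (f + t%:C *: g) h = ip f h + t%:C * ip g h.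
  by rewrite linearDl linearZl_LR.
by rewrite ReD ReZ; ring.
Qed.

Lemma riesz_energy_ge f : M f -> - (sqnorm h / A) <= J f.
Proof.
move=> Mf; have := Re_ip_young ip_norm A h f; rewrite ipC ReJ => young.
rewrite lerNl ler_pdivlMr //; have := ler_wpM2l (ltW A_gt0) (b_coercive Mf).
by rewrite /J; lra.
Qed.

(* The parallelogram identity for [f], [g] and their midpoint. *)
Lemma sqnormB_riesz_energy_le (m : R) f g : (forall f', M f' -> m <= J f') ->
  M f -> M g -> A * sqnorm (f - g) <= 2 * (J f - m) + 2 * (J g - m).
Proof.
move=> m_lbound Mf Mg; have Mfg := subspaceB M_sub Mf Mg.
have Jf := riesz_energyD 1 Mg Mfg; have Jmid := riesz_energyD 2^-1 Mg Mfg.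
have := m_lbound _ (subspaceD M_sub Mg (subspaceZ M_sub (2^-1)%:C Mfg)).
have := b_coercive Mfg; rewrite Jmid.
by move: Jf; rewrite rmorph1 scale1r addrC subrK => ->; lra.
Qed.

Lemma minimizing_seq_cvg (m : R) (u : nat -> H) : (forall f, M f -> m <= J f) ->
  (forall n, M (u n)) -> J (u n) @[n --> \oo] --> m -> cvg (u @ \oo).
Proof.
move=> m_lbound Mu /cvgrPdist_lt Ju; apply: cauchy_sqnorm_cvg => e e_gt0.
have : 0 < A * e / 4 by rewrite divr_gt0 // mulr_gt0.
move=> /Ju[N _ Ju_near]; exists N => n N_le_n.
have near_m k : (N <= k)%N -> J (u k) - m < A * e / 4.
  by move=> /Ju_near /=; rewrite ltr_norml => /andP[+ _]; lra.
rewrite -(ltr_pM2l A_gt0).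
apply: le_lt_trans (sqnormB_riesz_energy_le m_lbound (Mu N) (Mu n)) _.
by have := near_m N (leqnn N); have := near_m n N_le_n; lra.
Qed.

Lemma riesz_energy_lower_semicontinuous (m : R) (u : nat -> H) f :
  (forall n, M (u n)) -> u @ \oo --> f -> J (u n) @[n --> \oo] --> m ->
  M f /\ J f <= m.
Proof.
move=> Mu u_cvg Ju.
have b_cvg : Re (b (u n) (u n)) @[n --> \oo] --> m + 2 * Re (ip f h).
  under eq_fun => n do rewrite -[Re _](subrK (2 * Re (ip (u n) h))) -/(J _).
  apply: cvgD => //; apply: cvgM; first exact: cvg_cst.
  exact/cvg_Re/(cvg_ip ip_norm).
have sublevel (e : R) : 0 < e -> M f /\ Re (b f f) <= m + 2 * Re (ip f h) + e.
  move=> e_gt0; set l := _ + e.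
  have u_sub : \forall n \near \oo, M (u n) /\ Re (b (u n) (u n)) <= l.
    by near=> n; split=> //; near: n; apply: cvgr_le b_cvg _ _; rewrite ltrDl.
  exact: (closed_cvg _ (@b_sublevel_closed l) u_sub _ u_cvg).
split; first by have [] := sublevel 1 ltr01.
by apply/ler_addgt0Pr => e /sublevel[_]; rewrite /J; lra.
Unshelve. all: by end_near. Qed.

Lemma riesz_energy_has_minimizer : exists2 f, M f & forall g, M g -> J f <= J g.
Proof.
pose E := [set J f | f in M].
have E_lbound : lbound E (- (sqnorm h / A)).
  by move=> _ [g Mg <-]; exact: riesz_energy_ge.
have inf_lbound f : M f -> inf E <= J f.
  by move=> Mf; apply: ge_inf; [exists (- (sqnorm h / A))|exists f].
have infE : has_inf E.
  split; last by exists (- (sqnorm h / A)).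
  by exists (J 0), 0 => //; exact: subspace0.
have /choice[u u_min] n : exists f, M f /\ J f < inf E + harmonic n.
  by have [_ [f Mf <-] Jf] := inf_adherent (harmonic_gt0 n) infE; exists f.
have Mu n : M (u n) by case: (u_min n).
have Ju : J (u n) @[n --> \oo] --> inf E.
  apply: (@squeeze_cvgr _ _ _ _ (cst (inf E)) (fun n => inf E + harmonic n)).
  - by apply: nearW => n; rewrite inf_lbound //= ltW //; case: (u_min n).
  - exact: cvg_cst.
  - rewrite -[X in _ --> X]addr0.
    by apply: cvgD; [exact: cvg_cst|exact: cvg_harmonic].
have u_cvg := minimizing_seq_cvg inf_lbound Mu Ju.
have [Mf Jf] := riesz_energy_lower_semicontinuous Mu u_cvg Ju.
by exists (lim (u @ \oo)) => // g Mg; exact/(le_trans Jf)/inf_lbound.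
Qed.

Lemma minimizer_Re_representation f g : M f -> M g ->
  (forall f', M f' -> J f <= J f') -> Re (b f g) = Re (ip h g).
Proof.
move=> Mf Mg f_min; rewrite ipC ReJ; apply/eqP; rewrite -subr_eq0.
have q_ge0 := Re_sip_ge0 b_sip Mg.
apply/eqP/(linear_term_eq0 (q := Re (b g g) / 4)) => [|t].
  by rewrite divr_ge0.
have := f_min _ (subspaceD M_sub Mf (subspaceZ M_sub (t / 2)%:C Mg)).
by rewrite riesz_energyD //; lra.
Qed.

Theorem coercive_form_representation :
  exists2 f, M f & forall g, M g -> b f g = ip h g.
Proof.
have [f Mf f_min] := riesz_energy_has_minimizer; exists f => // g Mg.
have Re_eq g' Mg' := minimizer_Re_representation Mf (g := g') Mg' f_min.
have Mig := subspaceZ M_sub 'i Mg.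
have Im_eq : Im (b f g) = Im (ip h g).
  have := Re_eq _ Mig; rewrite (sipZr b_sip) // linearZr_LR /= conjC_i.
  by case: (b f g) (ip h g) => [? ?] [? ?] /=; lra.
by apply/eqP; rewrite eq_complex Re_eq // Im_eq !eqxx.
Qed.

End CoerciveRepresentation.

Section OrthogonalProjection.
Context {R : realType} {H : completeNormedModType R[i]}.
Variable ip : {dot H for conjC}.
Hypothesis ip_norm : forall f : H, ip f f = `|f| ^+ 2.
Variable M : set H.
Hypotheses (M_sub : subspace M) (M_closed : closed M).

Lemma orth_projP f :
  M (orth_proj ip M f) /\ forall g, M g -> ip (orth_proj ip M f) g = ip f g.
Proof.
have [g _|l|p Mp p_ip] := coercive_form_representation ip_norm
  (ip_sip ip M_sub) ltr01 _ _ f.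
- by rewrite mul1r ip_sqnorm.
- apply: closedI => //; pose q (g : H) := Re (ip g g).
  apply: (@preimage_closed _ _ q) (@closed_le _ l) => g _.
  rewrite /continuous_at /q; under eq_fun do rewrite ip_norm.
  rewrite ip_norm; apply: cvg_Re; apply: cvgM; exact: norm_continuous.
have proj_ex : exists p, M p /\ forall g, M g -> ip (f - p) g = 0.
  by exists p; split=> // g Mg; rewrite linearBl /= p_ip // subrr.
have [Mq q_orth] := xgetPex 0 proj_ex; split=> // g Mg.
by apply/eqP; rewrite eq_sym -subr_eq0 -linearBl /= q_orth.
Qed.

End OrthogonalProjection.

Section BesselSynthesis.
Context {R : realType} {H : completeNormedModType R[i]}.
Variable ip : {dot H for conjC}.
Hypothesis ip_norm : forall f : H, ip f f = `|f| ^+ 2.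
Implicit Types (f g : H) (eta : nat -> H) (c : nat -> R[i]^o).

Lemma ip_partial_sum n c eta f :
  ip (\sum_(0 <= k < n) c k *: eta k) f =
  partial_dot n c (analysis_op ip eta f).
Proof.
rewrite linear_sumlz; apply: eq_bigr => k _.
by rewrite linearZl_LR /analysis_op -ipC.
Qed.

Lemma bessel_square_summable eta f :
  bessel_sequence ip eta -> square_summable (analysis_op ip eta f).
Proof.
by move=> [B _ eta_bessel]; exact: le_lt_trans (eta_bessel f) (ltry _).
Qed.

Lemma bessel_sequence_perm (s : nat -> nat) eta : bijective s ->
  bessel_sequence ip eta -> bessel_sequence ip (eta \o s).
Proof.
move=> s_bij [B B_gt0 eta_bessel]; exists B => // f.
by rewrite -[analysis_op _ _ _]/(analysis_op ip eta f \o s) sum_sq_perm.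
Qed.

Lemma bessel_synthesis eta c g :
  bessel_sequence ip eta -> square_summable c ->
  (forall f, ip g f = l2_dot c (analysis_op ip eta f)) ->
  series (fun k => c k *: eta k) @ \oo --> g.
Proof.
move=> eta_bessel c_fin g_weak; have [B B_gt0 eta_le] := eta_bessel.
apply: cvg_sqnorm.
have tail_cvg : B * Re (l2_dot c c - partial_dot n c c) @[n --> \oo] --> 0.
  rewrite -[X in _ --> X](mulr0 B) -[X in B * X](subrr (Re (l2_dot c c))).
  apply: cvgM; first exact: cvg_cst.
  under eq_fun do rewrite ReD ReN.
  by apply: cvgB; [exact: cvg_cst|apply: cvg_Re; exact: cvg_l2_dot].
apply: squeeze_cvgr (cvg_cst 0) tail_cvg; apply: nearW => n.
rewrite sqr_ge0 /=; set d := g - _; pose coef := analysis_op ip eta d.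
have coef_fin : square_summable coef by exact: bessel_square_summable.
have d_tail : ip d d = l2_dot c coef - partial_dot n c coef.
  by rewrite {1}/d linearBl /= g_weak ip_partial_sum.
pose tail := Re (l2_dot coef coef - partial_dot n coef coef).
have tail_le : tail <= B * sqnorm d.
  apply: (@le_trans _ _ (Re (l2_dot coef coef))).
    by rewrite /tail ReD ReN gerBl (Re_sip_ge0 (partial_dot_sip n)).
  by rewrite -lee_fin Re_l2_dot_diag //; exact: eta_le.
(* With weight [B^-1] the tail of [coef] is absorbed into the left-hand side. *)
have := Re_sip_young (l2_tail_sip n) B^-1 c_fin coef_fin.
rewrite -d_tail ip_sqnorm //= -/tail => young; rewrite -ler_pdivrMl //.
have : B^-1 ^+ 2 * tail <= B^-1 * sqnorm d.
  by rewrite expr2 -mulrA ler_pM2l ?invr_gt0 // ler_pdivrMl.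
by lra.
Qed.

Lemma bessel_synthesis_unconditional eta c g :
  bessel_sequence ip eta -> square_summable c ->
  (forall f, ip g f = l2_dot c (analysis_op ip eta f)) ->
  unconditionally_sums_to (fun k => c k *: eta k) g.
Proof.
move=> eta_bessel c_fin g_weak s s_bij.
apply: (@bessel_synthesis (eta \o s) (c \o s)).
- exact: bessel_sequence_perm.
- exact/square_summable_perm.
- move=> f; rewrite -[analysis_op _ _ _]/(analysis_op ip eta f \o s).
  by rewrite l2_dot_perm //; exact: bessel_square_summable.
Qed.

End BesselSynthesis.

Section FrameForm.
Context {R : realType} {H : completeNormedModType R[i]}.
Variable ip : {dot H for conjC}.
Hypothesis ip_norm : forall f : H, ip f f = `|f| ^+ 2.
Variable xi : nat -> H.
Implicit Types f g h : H.

Local Notation D := (analysis_dom ip xi).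
Local Notation C := (analysis_op ip xi).
Local Notation M := (Hspace ip xi).

Definition frame_form f g : R[i] := l2_dot (C f) (C g).

Lemma analysis_op_linear : linear (C : H -> (nat -> R[i]^o)).
Proof.
move=> a f g; apply/funext => n.
by rewrite /analysis_op linearDl linearZl_LR.
Qed.

Lemma frame_form_sip : semi_inner_product D frame_form.
Proof. exact: sip_preimage analysis_op_linear l2_dot_sip. Qed.

Lemma Re_frame_form_diag f :
  D f -> (Re (frame_form f f))%:E = sum_sq (C f).
Proof. exact: Re_l2_dot_diag. Qed.

Lemma frame_form_sublevel_closed (l : R) :
  closed [set f | D f /\ Re (frame_form f f) <= l].
Proof.
have -> : [set f | D f /\ Re (frame_form f f) <= l] =
    \bigcap_n [set f | Re (partial_dot n (C f) (C f)) <= l].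
  apply/seteqP; split=> f.
    move=> [Df]; rewrite -lee_fin Re_frame_form_diag //.
    by move=> /sum_sq_leP + n _ => /(_ n); rewrite lee_fin.
  move=> f_le; have : (sum_sq (C f) <= l%:E)%E.
    by apply/sum_sq_leP => n; rewrite lee_fin; exact: f_le.
  move=> sum_le; have Df : D f by exact: le_lt_trans sum_le (ltry _).
  by split=> //; rewrite -lee_fin Re_frame_form_diag.
apply: closed_bigI => n _.
pose q f := Re (partial_dot n (C f) (C f)).
apply: (@preimage_closed _ _ q) (@closed_le _ l) => f _.
by apply: cvg_Re; apply: cvg_partial_dot => k; exact: cvg_ip.
Qed.

Lemma gframe_relP f h : D f ->
  gframe_rel ip xi f h <-> M h /\ forall g, D g -> frame_form f g = ip h g.
Proof.
move=> Df; have pairingE g :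
    series (fun n => C f n * ip (xi n) g : R[i]^o) =
    fun n => partial_dot n (C f) (C g).
  by apply/funext => n; apply: eq_bigr => k _; rewrite [ip (xi k) g]ipC.
rewrite /gframe_rel; split=> -[Mh fh]; split=> // g Dg.
  by apply: l2_dotP => //; have := fh g Dg; rewrite pairingE.
by rewrite pairingE -fh //; exact: cvg_l2_dot.
Qed.

Lemma Hspace_subspace : subspace M.
Proof. exact: closure_subspace (sip_subspace frame_form_sip). Qed.

Lemma analysis_dom_Hspace : D `<=` M.
Proof. exact: subset_closure. Qed.

Lemma Hspace_ip_inj h h' : M h -> M h' ->
  (forall g, D g -> ip h g = ip h' g) -> h = h'.
Proof.
move=> Mh Mh' hh'; apply/eqP; rewrite -subr_eq0; apply/eqP.
apply: sqnorm_eq0.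
have Md := subspaceB Hspace_subspace Mh Mh'.
apply: complexI; rewrite -(ip_sqnorm ip_norm).
apply: orthogonal_closure Md => // g Dg.
by rewrite ipC linearBl /= hh' // subrr rmorph0.
Qed.

Hypothesis xi_lower : lower_semi_frame ip xi.

Lemma frame_form_representation h :
  exists2 u, D u & forall g, D g -> frame_form u g = ip h g.
Proof.
have [A A_gt0 xi_ge] := xi_lower.
apply: (coercive_form_representation ip_norm frame_form_sip A_gt0) => [f Df|].
  by rewrite -lee_fin Re_frame_form_diag.
exact: frame_form_sublevel_closed.
Qed.

Lemma gframe_invP h : M h -> D (gframe_inv ip xi h) /\
  forall g, D g -> frame_form (gframe_inv ip xi h) g = ip h g.
Proof.
move=> Mh; have [f Df fh] := frame_form_representation h.
have rel_fh : gframe_rel ip xi f h by exact/gframe_relP.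
have op_f : gframe_op ip xi f = h.
  apply: xget_unique => // h' /(gframe_relP _ Df)[Mh' fh'].
  by apply: Hspace_ip_inj => // g Dg; rewrite -fh' // fh.
have inv_ex : exists f', gframe_dom ip xi f' /\ gframe_op ip xi f' = h.
  by exists f; split=> //; split=> //; exists h.
have [[D_inv rel_ex] op_inv] := xgetPex 0 inv_ex; split=> //.
suff /(gframe_relP _ D_inv)[] : gframe_rel ip xi (gframe_inv ip xi h) h by [].
by rewrite -[X in gframe_rel _ _ _ X]op_inv; exact: xgetPex rel_ex.
Qed.

Definition canonical_dual (n : nat) : H :=
  gframe_inv ip xi (orth_proj ip M (xi n)).

Lemma canonical_dualP n : D (canonical_dual n) /\
  forall g, D g -> frame_form (canonical_dual n) g = ip (xi n) g.
Proof.
have M_closed : closed M := @closed_closure _ _.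
have [Mp p_ip] := orth_projP ip_norm Hspace_subspace M_closed (xi n).
have [D_dual dual_ip] := gframe_invP Mp; split=> // g Dg.
by rewrite dual_ip // p_ip //; exact: analysis_dom_Hspace.
Qed.

Lemma canonical_dual_analysis f u : D u ->
  (forall g, D g -> frame_form u g = ip f g) ->
  analysis_op ip canonical_dual f = C u.
Proof.
move=> Du u_ip; apply/funext => n; have [D_dual dual_ip] := canonical_dualP n.
by rewrite /analysis_op -u_ip // (sipC frame_form_sip) // dual_ip // -ipC.
Qed.

Lemma canonical_dual_bessel : bessel_sequence ip canonical_dual.
Proof.
have [A A_gt0 xi_ge] := xi_lower; exists A^-1; first by rewrite invr_gt0.
move=> f; have [u Du u_ip] := frame_form_representation f.
rewrite (canonical_dual_analysis Du u_ip) -Re_frame_form_diag // lee_fin.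
rewrite ler_pdivlMl //.
have Au_le : A * sqnorm u <= Re (frame_form u u).
  by rewrite -lee_fin Re_frame_form_diag.
have := Re_ip_young ip_norm A f u; rewrite -u_ip //.
by have := ler_wpM2l (ltW A_gt0) Au_le; lra.
Qed.

Lemma canonical_dual_weak_expansion f g : D g ->
  ip g f = l2_dot (C g) (analysis_op ip canonical_dual f).
Proof.
move=> Dg; have [u Du u_ip] := frame_form_representation f.
rewrite (canonical_dual_analysis Du u_ip) -/(frame_form g u).
by rewrite (sipC frame_form_sip) // u_ip // -ipC.
Qed.

End FrameForm.

Theorem theorem4p1 (R : realType) (H : completeNormedModType R[i])
    (ip : {dot H for conjC})
    (ip_norm : forall f : H, ip f f = `|f| ^+ 2)
    (H_separable : separable H)
    (xi : nat -> H) (xi_lower : lower_semi_frame ip xi) :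
  let P := orth_proj ip (Hspace ip xi) in
  let eta := fun n => gframe_inv ip xi (P (xi n)) in
  bessel_sequence ip eta /\
  (forall g : H, analysis_dom ip xi g ->
     unconditionally_sums_to (fun n => ip g (xi n) *: eta n) g).
Proof.
have dual_bessel := canonical_dual_bessel ip_norm xi_lower.
split=> // g Dg; apply: bessel_synthesis_unconditional => // f.
exact: canonical_dual_weak_expansion.
Qed.
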